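(* Let $\mathcal{C}$ be a category, $M:\mathcal{C}\to\mathcal{C}$ a functor and $\psi:M\to \mathrm{id}_{\mathcal{C}}$ a natural transformation. If $(M,\psi)$ is an idempotent semicomonad on $\mathcal{C}$, then $(M,\psi)$ is an idempotent comonad on $\mathcal{C}$.
   Context: $M\psi:M^2\to M$ denotes the natural transformation with components $(M\psi)_x=M(\psi_x)$, and $\psi M:M^2\to M$ the natural transformation with components $(\psi M)_x=\psi_{Mx}$. The pair $(M,\psi)$ is an idempotent semicomonad on $\mathcal{C}$ when $M\psi$ and $\psi M$ are both natural isomorphisms (without requiring $M\psi=\psi M$). The pair $(M,\psi)$ is an idempotent comonad on $\mathcal{C}$ when $M\psi=\psi M$ and $M\psi$ is a natural isomorphism. *)

(* Defs.v *)
Set Implicit Arguments.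
Unset Strict Implicit.
Unset Printing Implicit Defensive.

Declare Scope cat_scope.
Delimit Scope cat_scope with cat.
Local Open Scope cat_scope.

(* [Ob] and [Hom x y] live in independent universes, so neither local smallness
   nor smallness is imposed; morphisms are compared by Leibniz equality. *)
Record Category := {
  Ob :> Type;
  Hom : Ob -> Ob -> Type;
  idm : forall x, Hom x x;
  comp : forall x y z, Hom y z -> Hom x y -> Hom x z;
  comp_idl : forall x y (f : Hom x y), comp (idm y) f = f;
  comp_idr : forall x y (f : Hom x y), comp f (idm x) = f;
  comp_assoc : forall w x y z (h : Hom y z) (g : Hom x y) (f : Hom w x),
    comp h (comp g f) = comp (comp h g) f }.

Arguments Hom {c} x y.
Arguments idm {c} x.
Arguments comp {c x y z} g f.

Notation "g ∘ f" := (comp g f) (at level 40, left associativity) : cat_scope.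

Definition is_iso (C : Category) (x y : C) (f : Hom x y) : Prop :=
  exists g : Hom y x, g ∘ f = idm x /\ f ∘ g = idm y.

Record Functor (C D : Category) := {
  fob :> C -> D;
  fmap : forall x y : C, Hom x y -> Hom (fob x) (fob y);
  fmap_id : forall x : C, fmap (idm x) = idm (fob x);
  fmap_comp : forall (x y z : C) (g : Hom y z) (f : Hom x y),
    fmap (g ∘ f) = fmap g ∘ fmap f }.

Arguments fmap {C D} F {x y} f : rename.

Definition id_functor (C : Category) : Functor C C.
Proof.
refine {| fob := fun x : C => x; fmap := fun x y f => f |}; reflexivity.
Defined.

Definition comp_functor (C D E : Category) (G : Functor D E) (F : Functor C D) :
  Functor C E.
Proof.
refine {| fob := fun x => G (F x); fmap := fun x y f => fmap G (fmap F f) |}.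
- intro x; rewrite fmap_id; apply fmap_id.
- intros x y z g f; rewrite fmap_comp; apply fmap_comp.
Defined.

Record NatTrans (C D : Category) (F G : Functor C D) := {
  component :> forall x : C, Hom (F x) (G x);
  naturality : forall (x y : C) (f : Hom x y),
    component y ∘ fmap F f = fmap G f ∘ component x }.

Definition is_nat_iso (C D : Category) (F G : Functor C D) (a : NatTrans F G) :
  Prop := forall x : C, is_iso (a x).

(* [M o id] and [id o M] are not convertible to [M], so the two
   whiskerings are given the target [M] directly: this makes them elements of
   the same type, which can be compared by [=]. *)
Definition whisker_l (C : Category) (M : Functor C C)
    (psi : NatTrans M (id_functor C)) : NatTrans (comp_functor M M) M.
Proof.
refine (@Build_NatTrans C C (comp_functor M M) M (fun x => fmap M (psi x)) _).
intros x y f; simpl.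
rewrite <- !fmap_comp; f_equal; apply (naturality psi).
Defined.

Definition whisker_r (C : Category) (M : Functor C C)
    (psi : NatTrans M (id_functor C)) : NatTrans (comp_functor M M) M.
Proof.
refine (@Build_NatTrans C C (comp_functor M M) M (fun x => psi (M x)) _).
intros x y f; apply (naturality psi).
Defined.

Definition idempotent_semicomonad (C : Category) (M : Functor C C)
    (psi : NatTrans M (id_functor C)) : Prop :=
  is_nat_iso (whisker_l psi) /\ is_nat_iso (whisker_r psi).

Definition idempotent_comonad (C : Category) (M : Functor C C)
    (psi : NatTrans M (id_functor C)) : Prop :=
  whisker_l psi = whisker_r psi /\ is_nat_iso (whisker_l psi).

(* Main.v *)
From Stdlib Require Import FunctionalExtensionality ProofIrrelevance.
Require Import Defs.

(** Write [a x] for [fmap M (psi x)] and [b x] for [psi (M x)]; both are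
    isomorphisms [M (M x) -> M x], and the point is that they coincide.

    Naturality of [psi] at [psi x] says that [psi x] equalizes [a x] and [b x].
    It cannot be cancelled there, [psi x] being arbitrary, but it can in two
    neighbouring instances.  Replacing [x] by [M x] turns [psi x] into the
    isomorphism [b x], so [a (M x) = b (M x)]; applying [M] turns it into the
    isomorphism [a x], so [fmap M (a x) = fmap M (b x)], where
    [fmap M (b x)] is by definition [a (M x)].  Hence
    [fmap M (a x) = b (M x)], and naturality of [psi] at [a x], that is
    [b x ∘ fmap M (a x) = a x ∘ b (M x)], becomes an equation between
    composites of [b x] and [a x] with one and the same isomorphism, which is
    then cancelled on the right. *)

Local Open Scope cat_scope.

Lemma is_iso_monic {C : Category} {x y z : C} {f : Hom y z} {g h : Hom x y} :
  is_iso f -> f ∘ g = f ∘ h -> g = h.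
Proof.
  intros [k [kf _]] E.
  rewrite <- (comp_idl g), <- (comp_idl h), <- kf, <- !comp_assoc, E.
  reflexivity.
Qed.

Lemma is_iso_epic {C : Category} {x y z : C} {f : Hom x y} {g h : Hom y z} :
  is_iso f -> g ∘ f = h ∘ f -> g = h.
Proof.
  intros [k [_ fk]] E.
  rewrite <- (comp_idr g), <- (comp_idr h), <- fk, !comp_assoc, E.
  reflexivity.
Qed.

(** Naturality is a family of propositions, so proof irrelevance leaves only the
    components to compare. *)
Lemma nat_trans_ext (C D : Category) (F G : Functor C D) (s t : NatTrans F G) :
  (forall x, s x = t x) -> s = t.
Proof.
  destruct s as [s ns], t as [t nt]; simpl; intro E.
  apply functional_extensionality_dep in E; subst t.
  f_equal; apply proof_irrelevance.
Qed.

Section Copointed.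

Context {C : Category} {M : Functor C C} (psi : NatTrans M (id_functor C)).

Lemma counit_equalizes_whiskers (x : C) :
  psi x ∘ fmap M (psi x) = psi x ∘ psi (M x).
Proof. exact (naturality psi (psi x)). Qed.

(** The instance of [counit_equalizes_whiskers] in which the common left factor
    is a component of [whisker_r psi]. *)
Lemma whiskers_agree_on_image (x : C) :
  is_iso (psi (M x)) -> fmap M (psi (M x)) = psi (M (M x)).
Proof.
  intro Hb; apply (is_iso_monic Hb); apply counit_equalizes_whiskers.
Qed.

(** The image of [counit_equalizes_whiskers] under [M], in which the common left
    factor is a component of [whisker_l psi]. *)
Lemma whiskers_agree_under_functor (x : C) :
  is_iso (fmap M (psi x)) -> fmap M (fmap M (psi x)) = fmap M (psi (M x)).
Proof.
  intro Ha; apply (is_iso_monic Ha).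
  rewrite <- !fmap_comp; f_equal; apply counit_equalizes_whiskers.
Qed.

End Copointed.

Theorem corollary3p6 : forall (C : Category) (M : Functor C C)
    (psi : NatTrans M (id_functor C)),
  idempotent_semicomonad psi -> idempotent_comonad psi.
Proof.
  intros C M psi [Ha Hb]; split; [|exact Ha].
  apply nat_trans_ext; intro x; simpl.
  apply (is_iso_epic (Hb (M x))); simpl.
  assert (E : fmap M (fmap M (psi x)) = psi (M (M x))).
  { rewrite (whiskers_agree_under_functor psi x (Ha x)).
    exact (whiskers_agree_on_image psi x (Hb x)). }
  transitivity (psi (M x) ∘ fmap M (fmap M (psi x))).
  - symmetry; exact (naturality psi (fmap M (psi x))).
  - rewrite E; reflexivity.
Qed.
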